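(* The $3\times 3$-grid $G_3$ has an $\operatorname{mm}$-tangle of order $3$, i.e., there is a collection $\mathcal{T}$ of subsets of $V(G_3)$ such that (T1) for every $S\subseteq V(G_3)$ with $\operatorname{mm}_{G_3}(S)\le 2$, one of $S$ and $V(G_3)\setminus S$ belongs to $\mathcal{T}$; (T2) for all $S_1,S_2,S_3\in\mathcal{T}$, $S_1\cup S_2\cup S_3\neq V(G_3)$; (T3) for every $x\in V(G_3)$, $V(G_3)\setminus\{x\}\notin\mathcal{T}$.
   Context: The $3\times 3$-grid $G_3$ has vertex set $\{(i,j):1\le i,j\le 3\}$ and edges $(i,j)(i',j')$ with $|i-i'|+|j-j'|=1$. For a graph $G$ and $A\subseteq V(G)$, $\operatorname{mm}_G(A)$ is the size of a maximum matching among the edges of $G$ with one end in $A$ and the other in $V(G)\setminus A$. In general, for a symmetric submodular integer function $f$ on subsets of a finite set $X$, an $f$-tangle of order $k+1$ is a collection of subsets of $X$ satisfying (T1) with $f(S)\le k$, (T2) and (T3). *)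

(* Defs.v *)
From mathcomp Require Import all_boot all_order all_algebra.

Set Implicit Arguments.
Unset Strict Implicit.
Unset Printing Implicit Defensive.

Record sgraph := SGraph {
  vertex :> finType;
  adj : rel vertex;
  adj_sym : symmetric adj;
  adj_irr : irreflexive adj
}.

(* Grid coordinates are numbered from 0 to n - 1. *)
Definition grid_adj (n : nat) : rel ('I_n * 'I_n) :=
  fun u v => `|u.1 - v.1| + `|u.2 - v.2| == 1.

Lemma grid_adj_sym (n : nat) : symmetric (@grid_adj n).
Proof. by move=> u v; rewrite /grid_adj distnC [X in _ + X]distnC. Qed.

Lemma grid_adj_irr (n : nat) : irreflexive (@grid_adj n).
Proof. by move=> u; rewrite /grid_adj !distnn. Qed.

Definition grid (n : nat) : sgraph :=
  @SGraph ('I_n * 'I_n)%type (@grid_adj n) (@grid_adj_sym n) (@grid_adj_irr n).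

Definition cut_edges (G : sgraph) (A : {set G}) : {set {set G}} :=
  [set [set x; y] | x in A, y in ~: A & adj x y].

(* An edge set is a matching when its edges are pairwise disjoint. *)
Definition mm (G : sgraph) (A : {set G}) : nat :=
  \max_(M : {set {set G}} | (M \subset cut_edges A) && trivIset M) #|M|.

(* T is an f-tangle of order k + 1. *)
Definition is_tangle (X : finType) (f : {set X} -> int) (k : nat)
    (T : {set {set X}}) : Prop :=
  [/\ forall S : {set X}, (f S <= k%:Z)%R -> S \in T \/ ~: S \in T,
      forall S1 S2 S3 : {set X}, S1 \in T -> S2 \in T -> S3 \in T ->
        S1 :|: S2 :|: S3 <> [set: X]
    & forall x : X, [set: X] :\ x \notin T].

(* Main.v *)
(** The tangle consists of the sets with at most two vertices and the sets of
    three vertices avoiding the center.  Three such sets could only cover the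
    nine vertices if each had three vertices, but then the center would be
    missed.  Conversely, an inspection of the [2 ^ 9] bipartitions of the grid
    shows that whenever neither side belongs to this collection, three pairwise
    disjoint edges cross the bipartition. *)

Require Import Defs.
From mathcomp Require Import all_boot all_order all_algebra.

Set Implicit Arguments.
Unset Strict Implicit.
Unset Printing Implicit Defensive.

Lemma cut_edge_mem (G : sgraph) (A : {set G}) (x y : G) :
  adj x y -> (x \in A) != (y \in A) -> [set x; y] \in cut_edges A.
Proof.
move=> xy; case Ax: (x \in A); case Ay: (y \in A) => // _.
- by apply/imset2P; exists x y; rewrite // inE inE Ay.
- by apply/imset2P; exists y x; rewrite 1?setUC // inE inE Ax adj_sym.
Qed.

(** A list of ordered pairs is easier to exhibit than a set of edges; uniqueness of the flattened
    ends makes the edges pairwise disjoint. *)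
Lemma size_matching_le_mm (G : sgraph) (A : {set G}) (s : seq (G * G)) :
    uniq (flatten [seq [:: e.1; e.2] | e <- s]) ->
    all (fun e => adj e.1 e.2 && ((e.1 \in A) != (e.2 \in A))) s ->
  size s <= mm A.
Proof.
move=> us crs.
(* The induction also records that members of [M] are nonempty and lie within the listed ends, so
   that the next edge is disjoint from all of them and hence not itself in [M]. *)
suff [M [MA tM <- _]] : exists M : {set {set G}},
    [/\ M \subset cut_edges A, trivIset M, #|M| = size s
      & forall B, B \in M -> B != set0 /\
          {subset B <= flatten [seq [:: e.1; e.2] | e <- s]}].
  by rewrite /mm (bigmax_sup M) ?MA.
elim: s us crs => [|[x y] s IHs] /=.
  move=> _ _; exists set0; split=> [|||B]; rewrite ?sub0set ?cards0 ?inE //.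
  by apply/trivIsetP => B; rewrite inE.
rewrite inE negb_or -andbA => /and4P[_ xs ys us] /andP[/andP[xy Axy] crs].
have [M [MA tM cM subM]] := IHs us crs.
have [||tM' xyM] := @trivIsetU1 _ [set x; y] M _ tM.
- move=> B /subM[_ sB]; rewrite disjoint_subset; apply/subsetP => z.
  by rewrite !inE => /orP[] /eqP->; apply/negP => /sB; apply/negP.
- by apply/negP => /subM[]; rewrite eqxx.
exists ([set x; y] |: M); split=> //.
- by rewrite subUset sub1set MA cut_edge_mem.
- by rewrite cardsU1 xyM cM.
move=> B /setU1P[-> | /subM[B0 sB]].
  split; first by apply/set0Pn; exists x; rewrite !inE eqxx.
  by move=> z; rewrite !inE orbA => ->.
by split=> // z /sB zs; rewrite !inE zs !orbT.
Qed.

(* The cells of the grid are numbered row by row. *)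
Definition cell (k : nat) : grid 3 :=
  (Ordinal (ltn_pmod (k %/ 3) (isT : 0 < 3)),
   Ordinal (ltn_pmod k (isT : 0 < 3))).

Definition center : grid 3 := cell 4.

Lemma cell_inj : {in gtn 9 &, injective cell}.
Proof.
move=> k l k9 l9 [] edi emo; rewrite (divn_eq k 3) (divn_eq l 3) emo.
by rewrite !modn_small ?ltn_divLR // in edi; rewrite edi.
Qed.

Lemma card_grid3 (S : {set grid 3}) :
  #|S| = \sum_(k < 9) (cell k \in S).
Proof.
rewrite -sum1_card big_mkcond (reindex (fun k : 'I_9 => cell k)) /=.
  by apply: eq_bigr => k _; case: (_ \in S).
apply: onW_bij; apply: inj_card_bij => [k l ekl|].
  by apply: val_inj; apply: cell_inj ekl; apply: ltn_ord.
by rewrite card_prod !card_ord.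
Qed.

(** The center has weight two and every other vertex weight one, so that a single bound on the
    weight describes the whole collection. *)
Definition small (S : {set grid 3}) : bool :=
  #|S| + (center \in S) <= 3.

Definition grid3_edges : seq (nat * nat) :=
  [:: (0, 1); (1, 2); (3, 4); (4, 5); (6, 7); (7, 8);
      (0, 3); (1, 4); (2, 5); (3, 6); (4, 7); (5, 8)].

(** Bit [k] of [b] tells the side of [cell k]. Working with bits and numbers instead of finite sets
    lets the search be evaluated. *)
Definition has_crossing3 (b : bitseq) : bool :=
  let c := [seq e <- grid3_edges | nth false b e.1 != nth false b e.2] in
  has (fun e1 => has (fun e2 => has (fun e3 =>
    uniq (flatten [seq [:: e.1; e.2] | e <- [:: e1; e2; e3]])) c) c) c.

(** The two sums are the weights of the two sides; [b4] is the bit of the center. *)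
Lemma has_crossing3_or_small (b0 b1 b2 b3 b4 b5 b6 b7 b8 : bool) :
  let b := [:: b0; b1; b2; b3; b4; b5; b6; b7; b8] in
  [|| sumn (map nat_of_bool b) + b4 <= 3,
      sumn (map (nat_of_bool \o negb) b) + ~~ b4 <= 3 | has_crossing3 b].
Proof.
by case: b0; case: b1; case: b2; case: b3; case: b4; case: b5; case: b6;
  case: b7; case: b8; vm_compute.
Qed.

Lemma has_crossing3_mm (S : {set grid 3}) :
  has_crossing3 [seq cell k \in S | k <- iota 0 9] -> 2 < mm S.
Proof.
have cross e :
    e \in [seq e <- grid3_edges |
            nth false [seq cell k \in S | k <- iota 0 9] e.1
            != nth false [seq cell k \in S | k <- iota 0 9] e.2] ->
    [/\ e.1 < 9, e.2 < 9 & adj (cell e.1) (cell e.2)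
          && ((cell e.1 \in S) != (cell e.2 \in S))].
  rewrite mem_filter => /andP[nS eE].
  have /allP/(_ e eE)/and3P[e1 e2 ->] :
    all (fun e => [&& e.1 < 9, e.2 < 9 & adj (cell e.1) (cell e.2)])
        grid3_edges by vm_compute.
  by move: nS; rewrite !(nth_map 0) ?size_iota // !nth_iota.
case/hasP=> e1 /cross[a1 b1 c1] /hasP[e2 /cross[a2 b2 c2]].
case/hasP=> e3 /cross[a3 b3 c3] ue.
apply: (@size_matching_le_mm _ S
  [seq (cell e.1, cell e.2) | e <- [:: e1; e2; e3]]); last first.
  by rewrite /= c1 c2 c3.
(* Distinct numbers below 9 give distinct vertices, so the three edges stay disjoint in the grid. *)
rewrite -(map_inj_in_uniq (f := cell)) // in ue.
have /allP all9 : all (gtn 9) (flatten [seq [:: e.1; e.2] | e <- [:: e1; e2; e3]]).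
  by rewrite /= a1 a2 a3 b1 b2 b3.
by move=> k l /all9 k9 /all9 l9; apply: cell_inj.
Qed.

Lemma mm_le2_small (S : {set grid 3}) :
  mm S <= 2 -> small S \/ small (~: S).
Proof.
rewrite leqNgt /small !card_grid3 !big_ord_recl !big_ord0 /= !inE => /negP nS.
have := has_crossing3_or_small (cell 0 \in S) (cell 1 \in S) (cell 2 \in S)
  (cell 3 \in S) (cell 4 \in S) (cell 5 \in S) (cell 6 \in S) (cell 7 \in S)
  (cell 8 \in S).
case/or3P=> [||/has_crossing3_mm/nS] //; by [left | right].
Qed.

Theorem lemma2p6 :
  exists T : {set {set grid 3}},
    is_tangle (fun S : {set grid 3} => (mm S)%:Z%R) 2 T.
Proof.
have card9 : #|[set: grid 3]| = 9 by rewrite cardsT card_prod !card_ord.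
exists [set S | small S]; split=> [S mmS | S1 S2 S3 | x].
- by rewrite !inE; apply: mm_le2_small.
- rewrite !inE /small => s1 s2 s3 cov.
  have := in_setT center; rewrite -cov !inE.
  have le9 : 9 <= #|S1| + #|S2| + #|S3|.
    rewrite -card9 -cov (leq_trans (leq_card_setU _ _)) // leq_add2r.
    exact: leq_card_setU.
  (* The three weights add up to at most 9, and covering the grid already uses 9, so none of the
     sets can contain the center. *)
  have : 9 + ((center \in S1) + (center \in S2) + (center \in S3)) <= 9.
    apply: leq_trans (leq_add le9 (leqnn _)) _.
    by rewrite addnACA (addnACA #|S1|) (leq_add (leq_add s1 s2) s3).
  by case: (_ \in S1); case: (_ \in S2); case: (_ \in S3).
- suff c8 : #|[set: grid 3] :\ x| = 8 by rewrite inE /small c8.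
  by apply: succn_inj; rewrite -card9 (cardsD1 x [set: grid 3]) in_setT.
Qed.
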